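(* Consider the penalized scenario-based Value-at-Risk portfolio problem $\min_{\mathbf{w}\in\Delta}\ \phi(\mathbf{w}) := g(\mathbf{w}) - h(\mathbf{w})$ and the Boosted DC Algorithm (BDCA) with the line search, both as described in the context. Let $\{\mathbf{w}_k\}$ and $\{\mathbf{y}_k\}$ be the sequences generated by the BDCA, with $\mathbf{d}_k=\mathbf{y}_k-\mathbf{w}_k$ and step sizes $\lambda_k$. Then: (i) for all $k\ge 0$, $\phi(\mathbf{y}_k)\le \phi(\mathbf{w}_k)-\rho\,\|\mathbf{d}_k\|^2$; (ii) the line search (the choice of the initial $\lambda_k$ followed by the backtracking loop) terminates after finitely many steps, and $\phi(\mathbf{w}_{k+1})\le \phi(\mathbf{w}_k)-\rho\,\lambda_k^2\,\|\mathbf{d}_k\|^2$; (iii) the sequence $\{\phi(\mathbf{w}_k)\}$ is monotonically decreasing and converges to some $\bar\phi\in\mathbb{R}$; (iv) there exists a subsequence of $\{\mathbf{w}_k\}$ converging to a KKT point of the problem $\min_{\mathbf{w}\in\Delta}\phi(\mathbf{w})$.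
   Context: Data: $n,S\in\mathbb{N}$; scenario vectors $\mathbf{x}_1,\dots,\mathbf{x}_S\in\mathbb{R}^n$ with probabilities $p_1,\dots,p_S\in[0,1]$, $\sum_j p_j=1$. The feasible set is the simplex $\Delta=\{\mathbf{w}\in[0,1]^n:\sum_{i=1}^n w_i=1\}$. For $\mathbf{w}\in\mathbb{R}^n$ relabel the scenarios so that $\mathbf{w}^\top\mathbf{x}_1\le\cdots\le\mathbf{w}^\top\mathbf{x}_S$; for a level $a\in(0,1)$ let $k=\max\{k: \sum_{j=1}^k p_j< a\}$ (with $\max\emptyset=0$) and $\varepsilon=a-\sum_{j=1}^k p_j$, and define the discrete conditional value-at-risk $\mathrm{CVaR}_{X,a}(\mathbf{w})=\frac1a\sum_{j=1}^k p_j\,\mathbf{w}^\top\mathbf{x}_j+\frac{\varepsilon}{a}\,\mathbf{w}^\top\mathbf{x}_{k+1}$ (a concave piecewise linear function of $\mathbf{w}$). Fix $\alpha\in(0,1)$, with $k,\varepsilon$ the quantities above for level $\alpha$, a constant $\gamma$ with $0<\gamma<\varepsilon$, a threshold $r_{\min}\in\mathbb{R}$, a penalty parameter $\tau>0$, a regularization parameter $\rho>0$, and $\psi(\mathbf{w})=\frac{\rho}{2}\|\mathbf{w}\|^2$. Let $f(\mathbf{w})=-\sum_{j=1}^S p_j\,\mathbf{w}^\top\mathbf{x}_j$ and $g(\mathbf{w})=\psi(\mathbf{w})+f(\mathbf{w})+\tau\max\big[-\tfrac{\alpha}{\gamma}\mathrm{CVaR}_{X,\alpha}(\mathbf{w})+r_{\min},\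 -\tfrac{\alpha-\gamma}{\gamma}\mathrm{CVaR}_{X,\alpha-\gamma}(\mathbf{w})\big]$, $h(\mathbf{w})=\psi(\mathbf{w})-\tau\,\tfrac{\alpha-\gamma}{\gamma}\mathrm{CVaR}_{X,\alpha-\gamma}(\mathbf{w})$, and $\phi=g-h$ (both $g$ and $h$ are $\rho$-strongly convex). BDCA: input $\mathbf{w}_0\in\Delta$, $\tau,\rho>0$, $\beta\in(0,1)$. For $k=0,1,2,\dots$: choose $\mathbf{u}_k\in\partial h(\mathbf{w}_k)$ (convex subdifferential); let $\mathbf{y}_k=\arg\min_{\mathbf{w}\in\Delta}\{g(\mathbf{w})-\mathbf{w}^\top\mathbf{u}_k\}$ (unique by strong convexity); $\mathbf{d}_k=\mathbf{y}_k-\mathbf{w}_k$; if $\|\mathbf{d}_k\|=0$ stop; otherwise set $\lambda_k=\max\{\lambda: \mathbf{w}_k+\lambda\mathbf{d}_k\in\Delta\}$ and, while $\phi(\mathbf{w}_k+\lambda_k\mathbf{d}_k)>\phi(\mathbf{w}_k)-\rho\lambda_k^2\|\mathbf{d}_k\|^2$, replace $\lambda_k$ by $\max\{1,\beta\lambda_k\}$; then set $\mathbf{w}_{k+1}=\mathbf{w}_k+\lambda_k\mathbf{d}_k$. A point $\bar{\mathbf{w}}$ is a KKT point of $\min_{\mathbf{w}\in\Delta}\phi$ if there exist $\pi_1,\dots,\pi_n\ge0$ and $\nu\in\mathbb{R}$ with $\mathbf{0}\in\partial g(\bar{\mathbf{w}})-\partial h(\bar{\mathbf{w}})-\sum_{i=1}^n\pi_i\mathbf{e}_i+\nu\mathbf{1}_n$,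 $\pi_i\bar w_i=0$ and $\bar w_i\ge0$ for all $i$, and $\mathbf{1}_n^\top\bar{\mathbf{w}}=1$, where $\mathbf{e}_i$ are the standard basis vectors and $\mathbf{1}_n$ is the all-ones vector. *)

(* Defs.v *)
From HB Require Import structures.
From mathcomp Require Import all_boot all_order all_algebra.
From mathcomp Require Import all_classical all_reals all_analysis.
Set Implicit Arguments. Unset Strict Implicit. Unset Printing Implicit Defensive.
Import Order.TTheory GRing.Theory Num.Theory.
Import numFieldNormedType.Exports.
Local Open Scope ring_scope.
Local Open Scope classical_set_scope.

Definition dotv (R : realType) (n : nat) (u v : 'rV[R]_n) : R :=
  \sum_(i < n) u 0 i * v 0 i.
Definition sqnorm (R : realType) (n : nat) (u : 'rV[R]_n) : R := dotv u u.

Definition in_simplex (R : realType) (n : nat) (w : 'rV[R]_n) : Prop :=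
  (forall i, 0 <= w 0 i <= 1) /\ \sum_(i < n) w 0 i = 1.

Definition scen_order (R : realType) (S : nat) (v : 'I_S -> R) : seq 'I_S :=
  sort (fun i j => v i <= v j) (enum 'I_S).
Definition sorted_probs (R : realType) (S : nat) (p : 'I_S -> R) (v : 'I_S -> R) : seq R :=
  [seq p i | i <- scen_order v].
Definition sorted_vals (R : realType) (S : nat) (v : 'I_S -> R) : seq R :=
  [seq v i | i <- scen_order v].
Definition psum (R : realType) (S : nat) (p v : 'I_S -> R) (k : nat) : R :=
  \sum_(j < k) nth 0 (sorted_probs p v) j.
(* k = max{k : sum_{j<=k} p_j < a} (max of empty = 0) *)
Definition cvar_k (R : realType) (S : nat) (p v : 'I_S -> R) (a : R) : nat :=
  \max_(k < S.+1 | (psum p v k < a)%R) (k : nat).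
Definition cvar_eps (R : realType) (S : nat) (p v : 'I_S -> R) (a : R) : R :=
  a - psum p v (cvar_k p v a).
Definition cvar_vals (R : realType) (S : nat) (p v : 'I_S -> R) (a : R) : R :=
  a^-1 * (\sum_(j < cvar_k p v a)
            nth 0 (sorted_probs p v) j * nth 0 (sorted_vals v) j)
  + cvar_eps p v a / a * nth 0 (sorted_vals v) (cvar_k p v a).

Definition port_vals (R : realType) (n S : nat) (x : 'I_S -> 'rV[R]_n)
  (w : 'rV[R]_n) : 'I_S -> R := fun j => dotv w (x j).

Definition CVaR (R : realType) (n S : nat) (x : 'I_S -> 'rV[R]_n) (p : 'I_S -> R)
  (a : R) (w : 'rV[R]_n) : R := cvar_vals p (port_vals x w) a.
Definition CVaR_eps (R : realType) (n S : nat) (x : 'I_S -> 'rV[R]_n) (p : 'I_S -> R)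
  (a : R) (w : 'rV[R]_n) : R := cvar_eps p (port_vals x w) a.

Definition psi (R : realType) (n : nat) (rho : R) (w : 'rV[R]_n) : R :=
  rho / 2 * sqnorm w.
Definition ffun_obj (R : realType) (n S : nat) (x : 'I_S -> 'rV[R]_n) (p : 'I_S -> R)
  (w : 'rV[R]_n) : R := - \sum_(j < S) p j * dotv w (x j).

Definition gfun (R : realType) (n S : nat) (x : 'I_S -> 'rV[R]_n) (p : 'I_S -> R)
  (al ga rmin tau rho : R) (w : 'rV[R]_n) : R :=
  psi rho w + ffun_obj x p w
  + tau * Num.max (- (al / ga) * CVaR x p al w + rmin)
                  (- ((al - ga) / ga) * CVaR x p (al - ga) w).
Definition hfun (R : realType) (n S : nat) (x : 'I_S -> 'rV[R]_n) (p : 'I_S -> R)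
  (al ga tau rho : R) (w : 'rV[R]_n) : R :=
  psi rho w - tau * ((al - ga) / ga) * CVaR x p (al - ga) w.
Definition phifun (R : realType) (n S : nat) (x : 'I_S -> 'rV[R]_n) (p : 'I_S -> R)
  (al ga rmin tau rho : R) (w : 'rV[R]_n) : R :=
  gfun x p al ga rmin tau rho w - hfun x p al ga tau rho w.

Definition subdiff (R : realType) (n : nat) (f : 'rV[R]_n -> R) (w u : 'rV[R]_n) : Prop :=
  forall z, f w + dotv u (z - w) <= f z.

Definition lam_max (R : realType) (n : nat) (w d : 'rV[R]_n) : R :=
  sup [set l : R | in_simplex (w + l *: d)].
Definition ls_trial (R : realType) (beta l0 : R) (j : nat) : R :=
  iter j (fun l => Num.max 1 (beta * l)) l0.
Definition armijo (R : realType) (n : nat) (phi : 'rV[R]_n -> R) (rho : R)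
  (w d : 'rV[R]_n) (l : R) : Prop :=
  phi (w + l *: d) <= phi w - rho * l ^+ 2 * sqnorm d.
Definition ls_output (R : realType) (n : nat) (phi : 'rV[R]_n -> R) (rho beta : R)
  (w d : 'rV[R]_n) (l : R) : Prop :=
  exists j : nat, armijo phi rho w d (ls_trial beta (lam_max w d) j)
    /\ (forall i, (i < j)%N -> ~ armijo phi rho w d (ls_trial beta (lam_max w d) i))
    /\ l = ls_trial beta (lam_max w d) j.

Definition is_KKT (R : realType) (n : nat) (g h : 'rV[R]_n -> R) (wb : 'rV[R]_n) : Prop :=
  exists (pi : 'I_n -> R) (nu : R) (a b : 'rV[R]_n),
    subdiff g wb a /\ subdiff h wb b /\
    a - b - \sum_(i < n) pi i *: delta_mx 0 i + nu *: const_mx 1 = 0 /\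
    (forall i, 0 <= pi i /\ pi i * wb 0 i = 0 /\ 0 <= wb 0 i) /\
    \sum_(i < n) wb 0 i = 1.

(* Main.v *)
Require Import Defs.
From HB Require Import structures.
From mathcomp Require Import all_boot all_order all_algebra.
From mathcomp Require Import all_classical all_reals all_analysis.
From mathcomp Require Import ring lra.
Set Implicit Arguments.
Unset Strict Implicit.
Unset Printing Implicit Defensive.
Import Order.TTheory GRing.Theory Num.Theory.
Import numFieldNormedType.Exports.
Local Open Scope ring_scope.
Local Open Scope classical_set_scope.

(* [a * CVaR_a] is the minimum of [\sum_j q_j (w . x_j)] over the weights
   [0 <= q <= p] of total mass [a]; hence [- CVaR_a] is convex with uniformly
   bounded subgradients, and [g] and [h] are [psi] plus functions of this kind.
   Strong convexity of [g] at its constrained minimiser [y_k] and of [h] at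
   [w_k] add up to the decrease [rho * |d_k|^2]; it makes the trial step 1
   acceptable, so backtracking stops, and it forces [d_k --> 0].  Along a
   subsequence [w_k] and the bounded [u_k] converge to some [wb] and [ub], with
   [ub] a subgradient of [h] at [wb] and [wb] a minimiser of
   [g - <., ub>] on the simplex.  A finite-dimensional Hahn-Banach argument
   then yields a subgradient [a] of that function at [wb] which is nonnegative
   on feasible directions, from which the multipliers are read off. *)

Section row_vectors.
Context {R : realType} {n : nat}.
Implicit Types (a b c : 'rV[R]_n) (t : R).

Lemma dotvC a b : dotv a b = dotv b a.
Proof. by apply: eq_bigr => i _; rewrite mulrC. Qed.

Fact dotv_is_scalar a : scalar (dotv a).
Proof.
move=> t b c; rewrite /dotv mulr_sumr -big_split; apply: eq_bigr => i _ /=.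
by rewrite !mxE mulrDr mulrCA.
Qed.

HB.instance Definition _ a :=
  GRing.isLinear.Build R 'rV[R]_n R *%R (dotv a) (dotv_is_scalar a).

Lemma dotvDr a b c : dotv a (b + c) = dotv a b + dotv a c.
Proof. exact: linearD. Qed.

Lemma dotvBr a b c : dotv a (b - c) = dotv a b - dotv a c.
Proof. exact: linearB. Qed.

Lemma dotvNr a b : dotv a (- b) = - dotv a b.
Proof. exact: linearN. Qed.

Lemma dotvZr t a b : dotv a (t *: b) = t * dotv a b.
Proof. exact: linearZ. Qed.

Lemma dotv0l a : dotv 0 a = 0.
Proof. by rewrite dotvC linear0. Qed.

Lemma dotvDl a b c : dotv (a + b) c = dotv a c + dotv b c.
Proof. by rewrite !(dotvC _ c) dotvDr. Qed.

Lemma dotvNl a b : dotv (- a) b = - dotv a b.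
Proof. by rewrite !(dotvC _ b) dotvNr. Qed.

Lemma dotvZl t a b : dotv (t *: a) b = t * dotv a b.
Proof. by rewrite !(dotvC _ b) dotvZr. Qed.

Lemma dotv_suml (I : Type) (r : seq I) (F : I -> 'rV[R]_n) a :
  dotv (\sum_(j <- r) F j) a = \sum_(j <- r) dotv (F j) a.
Proof.
by rewrite dotvC linear_sum; apply: eq_bigr => j _; rewrite dotvC.
Qed.

Lemma dotv_delta a i : dotv a (delta_mx 0 i) = a 0 i.
Proof.
rewrite /dotv (bigD1 i) //= mxE !eqxx mulr1 big1 ?addr0 // => j ji.
by rewrite mxE (negbTE ji) andbF mulr0.
Qed.

Lemma sqnorm0 : sqnorm (0 : 'rV[R]_n) = 0.
Proof. exact: dotv0l. Qed.

Lemma sqnormZ t a : sqnorm (t *: a) = t ^+ 2 * sqnorm a.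
Proof. by rewrite /sqnorm dotvZl dotvZr mulrA. Qed.

Lemma sqnormN a : sqnorm (- a) = sqnorm a.
Proof. by rewrite -scaleN1r sqnormZ sqrrN expr1n mul1r. Qed.

Lemma sqnormD a b : sqnorm (a + b) = sqnorm a + 2 * dotv a b + sqnorm b.
Proof. by rewrite /sqnorm dotvDl !dotvDr (dotvC b a); ring. Qed.

Lemma rV_norm_leP (M : R) a :
  0 <= M -> (`|a| <= M) <-> (forall i, `|a 0 i| <= M).
Proof.
move=> M0; rewrite /Num.Def.normr/= mx_normrE; split=> [/bigmax_leP[_ aM] i|aM].
  exact: (aM (0, i)).
apply/bigmax_leP; split=> // -[i j] _ /=; rewrite (ord1 i); exact: aM.
Qed.

Lemma coord_le_norm a i : `|a 0 i| <= `|a|.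
Proof. by move: i; apply/rV_norm_leP. Qed.

Lemma norm_delta_le i : `|delta_mx 0 i : 'rV[R]_n| <= 1.
Proof.
by apply/rV_norm_leP => // j; rewrite mxE eqxx/= normr_nat lern1 leq_b1.
Qed.

Lemma compact_norm_le (r : R) : compact [set z : 'rV[R]_n | `|z| <= r].
Proof.
apply: bounded_closed_compact.
  exists r; split=> [|r' r_lt z /= /le_trans]; first exact: num_real.
  by apply; exact: ltW.
apply: preimage_closed (@closed_le R r) => z _; exact: norm_continuous.
Qed.

Lemma norm_dotv_le a b : `|dotv a b| <= n%:R * (`|a| * `|b|).
Proof.
apply: le_trans (ler_norm_sum _ _ _) _.
rewrite -[n in n%:R]card_ord mulr_natl -sumr_const; apply: ler_sum => i _.
by rewrite normrM ler_pM// coord_le_norm.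
Qed.

Lemma sqnorm_ge0 a : 0 <= sqnorm a.
Proof. by apply: sumr_ge0 => i _; rewrite -expr2 sqr_ge0. Qed.

Lemma sqr_norm_le_sqnorm a : `|a| ^+ 2 <= sqnorm a.
Proof.
rewrite -[leRHS]sqr_sqrtr ?sqnorm_ge0// ler_pXn2r ?nnegrE ?sqrtr_ge0//.
apply/rV_norm_leP; first exact: sqrtr_ge0.
move=> i; rewrite -sqrtr_sqr ler_wsqrtr// /sqnorm /dotv (bigD1 i)//= -expr2.
by rewrite lerDl sumr_ge0// => j _; rewrite -expr2 sqr_ge0.
Qed.

Lemma cvg_dotv (T : Type) (F : set_system T) {FF : Filter F}
    (u v : T -> 'rV[R]_n) a b :
  u @ F --> a -> v @ F --> b -> dotv (u t) (v t) @[t --> F] --> dotv a b.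
Proof.
move=> ua vb; apply: cvg_big => [|i _]; first exact: add_continuous.
have coord (c : 'rV[R]_n) z : z @ F --> c -> z t 0 i @[t --> F] --> c 0 i.
  by move=> zc; exact: (cvg_comp z (fun v : 'rV[R]_n => v 0 i) zc
    (coord_continuous (x := c))).
by apply: cvgM; exact: coord.
Qed.

Lemma cvg_sqnorm0 (T : Type) (F : set_system T) {FF : Filter F}
    (u : T -> 'rV[R]_n) :
  sqnorm (u t) @[t --> F] --> 0 -> u @ F --> (0 : 'rV[R]_n).
Proof.
move=> su; apply/cvgr0Pnorm_le => e e0.
have e20 : 0 < e ^+ 2 by rewrite exprn_gt0.
have /cvgr0Pnorm_le/(_ _ e20) := su; apply: filterS => t.
move=> /(le_trans (ler_norm _)) /(le_trans (sqr_norm_le_sqnorm _)).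
by rewrite ler_pXn2r ?nnegrE ?(ltW e0).
Qed.

End row_vectors.

Section convexity.
Context {R : realType} {E : lmodType R}.

Lemma convex_setTP (A : set E) : convex_set A <->
  forall t a b, 0 <= t <= 1 -> A a -> A b -> A (t *: a + (1 - t) *: b).
Proof.
split=> [cA t a b /andP[t0 t1] Aa Ab|cA a b t]; last first.
  by rewrite !inE; apply: cA; rewrite ge0 le1.
by have := cA a b (Itv01 t0 t1); rewrite !inE; exact.
Qed.

Lemma convex_functionTP (f : E -> R) : convex_function [set: E] f <->
  forall t a b, 0 <= t <= 1 ->
    f (t *: a + (1 - t) *: b) <= t * f a + (1 - t) * f b.
Proof.
split=> [cf t a b /andP[t0 t1]|cf t a b _ _].
  by apply: (cf (Itv01 t0 t1)); rewrite inE.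
by apply: cf; rewrite ge0 le1.
Qed.

End convexity.

Definition strongly_convex {R : realType} {n : nat} (rho : R)
    (f : 'rV[R]_n -> R) : Prop :=
  convex_function [set: 'rV[R]_n] (fun z => f z - psi rho z).

Section strong_convexity.
Context {R : realType} {n : nat} (rho : R).
Implicit Types (f g h : 'rV[R]_n -> R) (a b u w y z : 'rV[R]_n).

Lemma psiN a : psi rho (- a) = psi rho a.
Proof. by rewrite /psi sqnormN. Qed.

Lemma continuous_psi : continuous (@psi R n rho).
Proof.
move=> w; have sqnorm_cvg : sqnorm z @[z --> w] --> sqnorm w.
  exact: (@cvg_dotv _ _ _ (nbhs w) _ id id w w cvg_id cvg_id).
exact: (cvgMl_tmp sqnorm_cvg).
Qed.

Lemma psi_conv t a b : psi rho (t *: a + (1 - t) *: b) =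
  t * psi rho a + (1 - t) * psi rho b - t * (1 - t) * psi rho (a - b).
Proof.
by rewrite /psi !sqnormD !sqnormZ sqnormN dotvZl !dotvZr dotvNr; ring.
Qed.

Lemma strongly_convex_secant f t a b : strongly_convex rho f -> 0 <= t <= 1 ->
  f (t *: a + (1 - t) *: b) + t * (1 - t) * psi rho (a - b)
    <= t * f a + (1 - t) * f b.
Proof.
by move=> /convex_functionTP fc /(fc _ a b); rewrite psi_conv; lra.
Qed.

Lemma strongly_convex_convex f : 0 <= rho ->
  strongly_convex rho f -> convex_function [set: 'rV[R]_n] f.
Proof.
move=> rho0 fc; apply/convex_functionTP => t a b t01.
apply: le_trans (strongly_convex_secant a b fc t01).
case/andP: t01 => t0 t1; rewrite lerDl !mulr_ge0 ?invr_ge0 ?subr_ge0//.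
exact: sqnorm_ge0.
Qed.

Lemma strongly_convexB_dotv f u : strongly_convex rho f ->
  strongly_convex rho (fun z => f z - dotv z u).
Proof.
move=> /convex_functionTP fc; apply/convex_functionTP => t a b /(fc _ a b).
by rewrite dotvDl !dotvZl; lra.
Qed.

Lemma strongly_convex_min f (K : set 'rV[R]_n) y z :
  strongly_convex rho f -> convex_set K -> K y -> K z ->
  (forall v, K v -> f y <= f v) -> f y + psi rho (z - y) <= f z.
Proof.
move=> fc /convex_setTP Kc Ky Kz ymin.
have secant t : 0 < t -> t <= 1 -> f y + (1 - t) * psi rho (z - y) <= f z.
  move=> t0 t1; have t01 : 0 <= t <= 1 by rewrite ltW.
  rewrite -(ler_pM2l t0).
  have := strongly_convex_secant z y fc t01.
  by have := ymin _ (Kc t z y t01 Kz Ky); lra.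
rewrite -[psi rho (z - y)]mul1r -[X in X * _](subr0 1).
apply: (@cvgr_to_le R 0^'+ _ _ (fun t : R => f y + (1 - t) * psi rho (z - y))).
  apply: cvg_at_right_filter; apply: cvgD; first exact: cvg_cst.
  by apply: cvgMr_tmp; apply: cvgB; [exact: cvg_cst|exact: cvg_id].
near=> t; apply: secant; first by near: t; exact: nbhs_right_gt.
near: t; exact: nbhs_right_le.
Unshelve. all: by end_near. Qed.

Lemma strongly_convex_subdiff f w u z :
  strongly_convex rho f -> subdiff f w u ->
  f w + dotv u (z - w) + psi rho (z - w) <= f z.
Proof.
move=> /(strongly_convexB_dotv u) fc fu.
have convT : convex_set [set: 'rV[R]_n] by apply/convex_setTP.
have wmin v : [set: 'rV[R]_n] v -> f w - dotv w u <= f v - dotv v u.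
  by move=> _; have := fu v; rewrite dotvBr !(dotvC u); lra.
have := strongly_convex_min (z := z) fc convT I I wmin.
by rewrite dotvBr !(dotvC u); lra.
Qed.

Lemma dca_decrease g h (K : set 'rV[R]_n) w y u :
  strongly_convex rho g -> strongly_convex rho h -> convex_set K ->
  K w -> K y -> subdiff h w u ->
  (forall v, K v -> g y - dotv y u <= g v - dotv v u) ->
  g y - h y <= g w - h w - rho * sqnorm (y - w).
Proof.
move=> /(strongly_convexB_dotv u) gc hc Kc Kw Ky hu ymin.
have := strongly_convex_min gc Kc Ky Kw ymin.
have := strongly_convex_subdiff y hc hu.
by rewrite -(opprB y w) psiN dotvBr !(dotvC u) /psi; lra.
Qed.

End strong_convexity.

Lemma lipschitz_continuous {R : realType} {V W : normedModType R}
    (f : V -> W) (k : R) :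
  (forall a b, `|f a - f b| <= k * `|a - b|) -> continuous f.
Proof.
move=> fk w; apply/subr_cvg0/norm_cvg0P.
have lim0 : k * `|z - w| @[z --> w] --> 0.
  rewrite -[X in _ --> X](mulr0 k) -(normr0 V) -(subrr w); apply: cvgMl_tmp.
  exact: (cvg_norm (cvgB cvg_id (cvg_cst w))).
have sandwich z : 0 <= `|f z - f w| <= k * `|z - w| by rewrite normr_ge0 fk.
exact: (squeeze_cvgr (nearW _ sandwich) (cvg_cst 0) lim0).
Qed.

(* Subgradients bounded uniformly in the point encode convexity and global
   Lipschitz continuity at once. *)
Definition bounded_subgradients {R : realType} {n : nat}
    (f : 'rV[R]_n -> R) : Prop :=
  exists M : R, forall w, exists2 s, subdiff f w s & `|s| <= M.

Section bounded_subgradients.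
Context {R : realType} {n : nat}.
Implicit Types f g : 'rV[R]_n -> R.

Lemma bounded_subgradientsD f g :
  bounded_subgradients f -> bounded_subgradients g ->
  bounded_subgradients (fun w => f w + g w).
Proof.
move=> [M fM] [N gN]; exists (M + N) => w.
have [s sf sM] := fM w; have [t tg tN] := gN w.
exists (s + t) => [z|]; first by rewrite dotvDl addrACA lerD.
by rewrite (le_trans (ler_normD _ _))// lerD.
Qed.

Lemma bounded_subgradientsZ c f : 0 <= c ->
  bounded_subgradients f -> bounded_subgradients (fun w => c * f w).
Proof.
move=> c0 [M fM]; exists (c * M) => w; have [s sf sM] := fM w.
exists (c *: s) => [z|]; last by rewrite normrZ ger0_norm// ler_wpM2l.
by rewrite dotvZl -mulrDr ler_wpM2l.
Qed.

Lemma bounded_subgradients_cst (c : R) :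
  bounded_subgradients (fun _ : 'rV[R]_n => c).
Proof.
by exists 0 => w; exists 0 => [z|]; rewrite ?normr0// dotv0l addr0.
Qed.

Lemma bounded_subgradients_dotv (a : 'rV[R]_n) : bounded_subgradients (dotv a).
Proof.
by exists `|a| => w; exists a => // z; rewrite -dotvDr addrC subrK.
Qed.

Lemma bounded_subgradients_max f g :
  bounded_subgradients f -> bounded_subgradients g ->
  bounded_subgradients (fun w => Num.max (f w) (g w)).
Proof.
move=> [M fM] [N gN]; exists (Num.max M N) => w.
have [s sf sM] := fM w; have [t tg tN] := gN w.
have [gf|/ltW fg] := leP (g w) (f w).
- by exists s => [z|]; rewrite le_max ?(max_idPl gf) ?sf ?sM.
- by exists t => [z|]; rewrite le_max ?(max_idPr fg) ?tg ?tN orbT.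
Qed.

Lemma bounded_subgradients_convex f :
  bounded_subgradients f -> convex_function [set: 'rV[R]_n] f.
Proof.
move=> [M fM]; apply/convex_functionTP => t a b /andP[t0 t1].
pose m := t *: a + (1 - t) *: b; have [s sf _] := fM m.
have sa := ler_wpM2l t0 (sf a).
have t1_ge0 : 0 <= 1 - t by rewrite subr_ge0.
have sb := ler_wpM2l t1_ge0 (sf b).
have : t * dotv s (a - m) + (1 - t) * dotv s (b - m) = 0.
  by rewrite /m !dotvBr !dotvDr !dotvZr; ring.
by rewrite -/m; lra.
Qed.

Lemma bounded_subgradients_continuous f :
  bounded_subgradients f -> continuous f.
Proof.
move=> [M fM].
have slope_le a b : f b - f a <= n%:R * M * `|b - a|.
  have [s sf sM] := fM b; have := sf a; rewrite -(opprB b a) dotvNr.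
  have := le_trans (ler_norm _) (norm_dotv_le s (b - a)).
  have : n%:R * (`|s| * `|b - a|) <= n%:R * M * `|b - a|.
    by rewrite -mulrA ler_wpM2l// ler_wpM2r.
  lra.
apply: (@lipschitz_continuous _ _ R^o f (n%:R * M)) => a b.
rewrite ler_norml slope_le andbT.
by have := slope_le a b; rewrite distrC; lra.
Qed.

Lemma bounded_subgradientsB_psi_continuous rho f :
  bounded_subgradients (fun z => f z - psi rho z) -> continuous f.
Proof.
move=> fb.
have -> : f = (fun z => f z - psi rho z) + psi rho.
  by apply/funext => z; rewrite !fctE subrK.
move=> w; apply: continuousD; last exact: continuous_psi.
exact: (bounded_subgradients_continuous fb).
Qed.

End bounded_subgradients.

Section hahn_banach_extension.
Context {R : realType} {E : lmodType R}.
Variables (p : E -> R) (l : {scalar E}) (V : set E) (e : E).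
Hypothesis p_convex : convex_function [set: E] p.
Hypotheses (V_convex : convex_set V) (V_neq0 : V !=set0).
Hypothesis l_le_p : forall z, V z -> l z <= p z.

Lemma slope_separation s t z z' : 0 < s -> 0 < t -> V z -> V z' ->
  (l z' - p (z' - s *: e)) / s <= (p (z + t *: e) - l z) / t.
Proof.
have /convex_functionTP pc := p_convex.
have /convex_setTP Vc := V_convex.
move=> s0 t0 Vz Vz'; have st0 : 0 < s + t by rewrite addr_gt0.
have [r rE r01] : exists2 r, (s + t) * r = s & 0 <= r <= 1.
  exists (s / (s + t)); first by rewrite mulrC divfK ?gt_eqF.
  by rewrite ler_pdivrMr// mul1r lerDl divr_ge0 ltW.
have combination : r *: (z + t *: e) + (1 - r) *: (z' - s *: e)
    = r *: z + (1 - r) *: z'.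
  rewrite !scalerDr scalerN !scalerA addrACA (_ : (1 - r) * s = r * t).
    by rewrite subrr addr0.
  by rewrite mulrBl mul1r -[X in X - _]rE; ring.
have balance : s * l z + t * l z' <= s * p (z + t *: e) + t * p (z' - s *: e).
  have := pc _ (z + t *: e) (z' - s *: e) r01.
  have Vr := Vc _ _ _ r01 Vz Vz'.
  have lE : l (r *: z + (1 - r) *: z') = r * l z + (1 - r) * l z'.
    by rewrite linearD !linearZ.
  rewrite combination => /(le_trans (l_le_p Vr)); rewrite lE -(ler_pM2l st0).
  by rewrite !mulrDr !mulrA mulrBr mulr1 rE; lra.
by rewrite ler_pdivrMr// mulrAC ler_pdivlMr//; lra.
Qed.

Lemma hahn_banach_extend1 :
  exists c, forall z t, V z -> l z + c * t <= p (z + t *: e).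
Proof.
have [z0 Vz0] := V_neq0.
pose slopes := [set r | exists s z,
  [/\ 0 < s, V z & r = (l z - p (z - s *: e)) / s]].
have slopes_neq0 : slopes !=set0.
  by exists ((l z0 - p (z0 - 1 *: e)) / 1), 1, z0.
have slopes_ub t z : 0 < t -> V z -> ubound slopes ((p (z + t *: e) - l z) / t).
  by move=> t0 Vz _ [s [z' [s0 Vz' ->]]]; exact: slope_separation.
exists (sup slopes) => z t Vz.
have [t0|t0|->] := ltgtP t 0; last by rewrite mulr0 addr0 scale0r addr0 l_le_p.
- have : slopes ((l z - p (z - (- t) *: e)) / (- t)).
    by exists (- t), z; rewrite oppr_gt0.
  have ub : has_ubound slopes.
    by exists ((p (z + 1 *: e) - l z) / 1); exact: slopes_ub.
  move=> /(ub_le_sup ub); rewrite ler_pdivrMr ?oppr_gt0// scaleNr opprK.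
  by lra.
- have := ge_sup slopes_neq0 (slopes_ub t z t0 Vz).
  by rewrite ler_pdivlMr//; lra.
Qed.

End hahn_banach_extension.

Section inf_translate.
Context {R : realType} {E : lmodType R}.
Variables (f : E -> R) (K : set E).
Hypotheses (f_convex : convex_function [set: E] f) (K_convex : convex_set K).

Definition inf_translate (d : E) : R := inf [set f (z + d) | z in K].

Lemma has_lbound_translate w : K w -> (forall z, K z -> f w <= f z) ->
  forall d, has_lbound [set f (z + d) | z in K].
Proof.
have /convex_functionTP fc := f_convex.
have /convex_setTP Kc := K_convex.
move=> Kw wmin d; exists (2 * f w - f (w - d)) => _ [z Kz <-].
have half : 0 <= (2^-1 : R) <= 1 by lra.
have := fc _ (z + d) (w - d) half.
rewrite scalerBr !scalerDr (_ : 1 - 2^-1 = 2^-1 :> R); last by field.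
have := wmin _ (Kc _ _ _ half Kz Kw).
rewrite addrACA subrr addr0 (_ : 1 - 2^-1 = 2^-1 :> R); last by field.
lra.
Qed.

Hypothesis K_neq0 : K !=set0.
Hypothesis f_lbound : forall d, has_lbound [set f (z + d) | z in K].

Lemma inf_translate_le z d : K z -> inf_translate d <= f (z + d).
Proof. by move=> Kz; apply: ge_inf; [exact: f_lbound|exists z]. Qed.

Lemma inf_translate_convex : convex_function [set: E] inf_translate.
Proof.
have /convex_functionTP fc := f_convex.
have /convex_setTP Kc := K_convex.
apply/convex_functionTP => t d d' t01; case/andP: (t01) => t0 t1.
have approx c e : 0 < e -> exists2 z, K z & f (z + c) < inf_translate c + e.
  move=> e0; have [z0 Kz0] := K_neq0.
  have hinf : has_inf [set f (z + c) | z in K].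
    by split; [exists (f (z0 + c)), z0|exact: f_lbound].
  by have [_ [z Kz <-] fz] := inf_adherent e0 hinf; exists z.
apply/ler_addgt0Pr => e e0.
have [z Kz /ltW fz] := approx d e e0; have [z' Kz' /ltW fz'] := approx d' e e0.
have := inf_translate_le (t *: d + (1 - t) *: d') (Kc _ _ _ t01 Kz Kz').
rewrite addrACA -!scalerDr => /le_trans /(_ (fc _ _ _ t01)).
have : (1 - t) * f (z' + d') <= (1 - t) * (inf_translate d' + e).
  by rewrite ler_wpM2l// subr_ge0.
by have := ler_wpM2l t0 fz; lra.
Qed.

End inf_translate.

Section constrained_minimum.
Context {R : realType} {n : nat}.
Implicit Types (f p : 'rV[R]_n -> R) (a w z : 'rV[R]_n).

Lemma convex_linear_minorant p : convex_function [set: 'rV[R]_n] p ->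
  0 <= p 0 -> exists a, forall z, dotv a z <= p z.
Proof.
move=> p_convex p0.
pose V (m : nat) :=
  [set z : 'rV[R]_n | forall i : 'I_n, (m <= i)%N -> z 0 i = 0].
suff minorant m : exists a, forall z, V m z -> dotv a z <= p z.
  have [a aV] := minorant n; exists a => z; apply: aV => i.
  by rewrite leqNgt ltn_ord.
elim: m => [|m [a aV]].
  exists 0 => z Vz; rewrite (_ : z = 0) ?dotv0l//.
  by apply/rowP => i; rewrite Vz// mxE.
have [mn|nm] := ltnP m n; last first.
  exists a => z _; apply: aV => i mi.
  by have := leq_trans nm mi; rewrite leqNgt ltn_ord.
pose im := Ordinal mn.
have V_convex : convex_set (V m).
  apply/convex_setTP => t z z' _ Vz Vz' i mi.
  by rewrite !mxE Vz// Vz'// !mulr0 addr0.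
have V_neq0 : V m !=set0 by exists 0 => i _; rewrite mxE.
have [c cP] := hahn_banach_extend1 (l := dotv a) (delta_mx 0 im)
  p_convex V_convex V_neq0 aV.
exists (a + (c - a 0 im) *: delta_mx 0 im) => z Vz.
have Vz0 : V m (z - z 0 im *: delta_mx 0 im).
  move=> i mi; rewrite !mxE eqxx/=.
  have [->|/eqP i_neq_m] := eqVneq i im; first by rewrite mulr1 subrr.
  rewrite mulr0 subr0 Vz// ltn_neqAle mi andbT; apply/eqP => m_eq_i.
  by apply: i_neq_m; exact/val_inj.
have /= := cP _ (z 0 im) Vz0; rewrite subrK; apply: le_trans.
rewrite dotvDl dotvZl (dotvC (delta_mx _ _)) dotv_delta.
by rewrite dotvBr dotvZr dotv_delta; lra.
Qed.

(* [d |-> inf_(z in K) f (z + d) - f w] is convex, and nonnegative at 0 because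
   [w] is a minimiser: any linear minorant of it is the required subgradient. *)
Lemma constrained_min_subgradient f (K : set 'rV[R]_n) w :
  convex_function [set: 'rV[R]_n] f -> convex_set K -> K w ->
  (forall z, K z -> f w <= f z) ->
  exists2 a, subdiff f w a & forall z, K z -> 0 <= dotv a (z - w).
Proof.
move=> fc Kc Kw wmin.
have lb := has_lbound_translate fc Kc Kw wmin.
have K_neq0 : K !=set0 by exists w.
pose p d := inf_translate f K d - f w.
have p_convex : convex_function [set: 'rV[R]_n] p.
  have /convex_functionTP infc := inf_translate_convex fc Kc K_neq0 lb.
  by apply/convex_functionTP => t a b /(infc _ a b); rewrite /p; lra.
have p0 : 0 <= p 0.
  rewrite subr_ge0; apply: lb_le_inf => [|_ [z Kz <-]].
    by exists (f (w + 0)), w.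
  by rewrite addr0 wmin.
have [a ap] := convex_linear_minorant p_convex p0; exists a.
  move=> z; have := ap (z - w); have := inf_translate_le lb (z - w) Kw.
  by rewrite subrKC /p; lra.
move=> z Kz; have := ap (w - z); have := inf_translate_le lb (w - z) Kz.
by rewrite subrKC /p -(opprB z w) dotvNr; lra.
Qed.

End constrained_minimum.

Section sequences.
Context {R : realType}.

Lemma increasing_seq_cvg (s : nat -> nat) : increasing_seq s -> s @ \oo --> \oo.
Proof.
move=> s_incr; apply/cvgnyPge => A; exists A => // k /= /leq_trans; apply.
elim: k => // k /leq_ltn_trans; apply.
by move/increasing_seqP : s_incr; exact.
Qed.

Lemma compact_subsequence {V : normedModType R} (A : set V) (z : nat -> V) :
  compact A -> (forall k, A (z k)) ->
  exists l : V, exists2 s : nat -> nat, increasing_seq s & z \o s @ \oo --> l.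
Proof.
move=> cA Az; have zA : (z @ \oo) A by exists 0%N => // k _; exact: Az.
have [l [_ zl]] := cA _ _ zA; exists l.
have : cluster (`|z k - l| @[k --> \oo]) 0.
  move=> B C zB nC; have nCl : nbhs l [set v | C `|v - l|].
    have : `|v - l| @[v --> l] --> `|l - l|.
      exact: (cvg_norm (cvgB cvg_id (cvg_cst l))).
    by rewrite subrr normr0; exact.
  by have [v [Bv Cv]] := zl [set v | B `|v - l|] _ zB nCl; exists `|v - l|.
move=> /cluster_eventually_cvg[s s_incr sl]; exists s => //.
exact/subr_cvg0/norm_cvg0P.
Qed.

Lemma sufficient_decrease_cvg0 (phi a : nat -> R) :
  cvgn phi -> (forall k, 0 <= a k) -> (forall k, phi k.+1 <= phi k - a k) ->
  a @ \oo --> 0.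
Proof.
move=> /cvg_ex[l phil] a0 dec.
have diff0 : phi k - phi k.+1 @[k --> \oo] --> 0.
  by rewrite -(subrr l); apply: cvgB => //; rewrite (cvg_shiftS phi).
have sandwich k : 0 <= a k <= phi k - phi k.+1.
  by rewrite a0/=; have := dec k; lra.
exact: (squeeze_cvgr (nearW _ sandwich) (cvg_cst 0) diff0).
Qed.

End sequences.

Section subdifferential.
Context {R : realType} {n : nat}.
Implicit Types (h : 'rV[R]_n -> R) (u w : 'rV[R]_n).

Lemma subdiff_closed h (w u : nat -> 'rV[R]_n) wb ub : continuous h ->
  w @ \oo --> wb -> u @ \oo --> ub ->
  (forall k, subdiff h (w k) (u k)) -> subdiff h wb ub.
Proof.
move=> hc wwb uub hu z.
have lhs : h (w k) + dotv (u k) (z - w k) @[k --> \oo]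
    --> h wb + dotv ub (z - wb).
  apply: cvgD; first exact: (cvg_comp w h wwb (hc wb)).
  exact: (cvg_dotv uub (cvgB (cvg_cst z) wwb)).
by apply: (cvgr_to_le lhs); apply: nearW => k; exact: hu.
Qed.

Lemma subdiff_bounded h (r : R) : continuous h ->
  exists B, forall w u, `|w| <= r -> subdiff h w u -> `|u| <= B.
Proof.
move=> hc; pose ball := [set z : 'rV[R]_n | `|z| <= r + 1].
have /compact_bounded[M [_ hM]] : compact (h @` ball).
  apply: continuous_compact; first exact: continuous_subspaceT.
  exact: compact_norm_le.
have {}hM z : `|z| <= r + 1 -> `|h z| <= M + 1.
  by move=> zr; apply: (hM (M + 1)); [rewrite ltrDl|exists z].
exists (2 * (M + 1)) => w u wr hu.
have hw : `|h w| <= M + 1 by apply: hM; lra.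
apply/rV_norm_leP; first by have := normr_ge0 (h w); lra.
move=> i; have bound t : `|t| = 1 -> t * u 0 i <= 2 * (M + 1).
  move=> t1; have := hu (w + t *: delta_mx 0 i).
  rewrite addrAC subrr add0r dotvZr dotv_delta.
  have : `|h (w + t *: delta_mx 0 i)| <= M + 1.
    apply: hM; apply: le_trans (ler_normD _ _) _; apply: lerD => //.
    by rewrite normrZ t1 mul1r norm_delta_le.
  by move: hw; rewrite !ler_norml => /andP[? ?] /andP[? ?]; lra.
have := bound 1 (normr1 _); have := bound (-1) (normrN1 _).
by rewrite mulN1r mul1r ler_norml => ? ?; apply/andP; split; lra.
Qed.

End subdifferential.

Section simplex.
Context {R : realType} {n : nat}.
Implicit Types (g h : 'rV[R]_n -> R) (w y d : 'rV[R]_n).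

Lemma in_simplexP w : in_simplex w <->
  (forall i, 0 <= w 0 i) /\ \sum_(i < n) w 0 i = 1.
Proof.
split=> -[w0 w1]; split=> // i; first by case/andP: (w0 i).
rewrite w0/= -w1 (bigD1 i)//= lerDl; exact: sumr_ge0.
Qed.

Lemma simplex_convex : convex_set (@in_simplex R n).
Proof.
apply/convex_setTP => t a b /andP[t0 t1].
move=> /in_simplexP[a0 a1] /in_simplexP[b0 b1].
apply/in_simplexP; split=> [i|].
  by rewrite !mxE addr_ge0// mulr_ge0// subr_ge0.
under eq_bigr do rewrite !mxE.
by rewrite big_split/= -!mulr_sumr a1 b1 !mulr1 addrC subrK.
Qed.

Lemma simplex_norm_le1 w : in_simplex w -> `|w| <= 1.
Proof.
move=> [w01 _]; apply/rV_norm_leP => // i.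
by have /andP[w0 w1] := w01 i; rewrite ger0_norm.
Qed.

Lemma simplex_closed : closed (@in_simplex R n).
Proof.
rewrite (_ : @in_simplex R n = \bigcap_i [set w : 'rV[R]_n | 0 <= w 0 i]
    `&` [set w | dotv (const_mx 1) w = 1]).
  apply: closedI.
    apply: closed_bigI => i _; apply: preimage_closed (@closed_ge R 0) => w _.
    exact: coord_continuous.
  apply: preimage_closed (@closed_eq R 1) => w _.
  exact: (@cvg_dotv _ _ _ (nbhs w) _ (cst _) id _ w (cvg_cst _) cvg_id).
have sumE w : dotv (const_mx 1) w = \sum_i w 0 i.
  by apply: eq_bigr => i _; rewrite mxE mul1r.
apply/seteqP; split=> w /=; rewrite sumE.
  by move=> /in_simplexP[w0 w1]; split=> // i _; exact: w0.
by move=> [w0 w1]; apply/in_simplexP; split=> // i; exact: w0.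
Qed.

Lemma simplex_compact : compact (@in_simplex R n).
Proof.
apply: subclosed_compact simplex_closed (@compact_norm_le R n 1) _ => w.
exact: simplex_norm_le1.
Qed.

Lemma simplex_delta i : in_simplex (delta_mx 0 i : 'rV[R]_n).
Proof.
apply/in_simplexP; split=> [j|]; first by rewrite mxE ler0n.
rewrite (bigD1 i)//= mxE !eqxx big1 ?addr0// => j ji.
by rewrite mxE (negbTE ji) andbF.
Qed.

(* The multipliers are [pi_i = <a, e_i - w>] and [nu = - <a, w>]: they are
   nonnegative because [e_i] is feasible, and complementary to [w] because
   their average with weights [w] vanishes. *)
Lemma simplex_min_KKT g h w b :
  convex_function [set: 'rV[R]_n] (fun z => g z - dotv z b) ->
  subdiff h w b -> in_simplex w ->
  (forall z, in_simplex z -> g w - dotv w b <= g z - dotv z b) ->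
  is_KKT g h w.
Proof.
move=> gc hb Dw wmin.
have [a ag aD] := constrained_min_subgradient gc simplex_convex Dw wmin.
have /in_simplexP[w0 w1] := Dw.
pose pi i := a 0 i - dotv a w.
have pi0 i : 0 <= pi i.
  by have := aD _ (simplex_delta i); rewrite dotvBr dotv_delta.
have pi_w0 i : pi i * w 0 i = 0.
  have : \sum_(j < n) pi j * w 0 j == 0.
    under eq_bigr do rewrite mulrBl.
    by rewrite sumrB -mulr_sumr w1 mulr1 subrr.
  rewrite psumr_eq0 => [|j _]; last by rewrite mulr_ge0.
  by move=> /allP/(_ i (mem_index_enum _))/eqP.
exists pi, (- dotv a w), (a + b), b; split=> [z|].
  by have := ag z; rewrite dotvDl (dotvBr b) !(dotvC b); lra.
split=> //; split; last by [].
have -> : \sum_(i < n) pi i *: delta_mx 0 i = \row_i pi i :> 'rV_n.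
  by rewrite [RHS]row_sum_delta; apply: eq_bigr => i _; rewrite mxE.
by apply/rowP => i; rewrite !mxE /pi; ring.
Qed.

End simplex.

Section feasible_steps.
Context {R : realType} {n : nat}.
Implicit Types (w d : 'rV[R]_n) (l : R).

Lemma has_ubound_steps w d : d != 0 ->
  has_ubound [set l : R | in_simplex (w + l *: d)].
Proof.
move=> d0; exists ((1 + `|w|) / `|d|) => l /simplex_norm_le1 wld1.
rewrite ler_pdivlMr ?normr_gt0//.
apply: le_trans (ler_wpM2r (normr_ge0 d) (ler_norm l)) _.
have := ler_normB (w + l *: d) w; rewrite -normrZ addrAC subrr add0r.
by move=> /le_trans; apply; rewrite lerD2r.
Qed.

Lemma lam_max_ge w d l : d != 0 -> in_simplex (w + l *: d) -> l <= lam_max w d.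
Proof. by move=> d0 Dl; apply: ub_le_sup => //; exact: has_ubound_steps. Qed.

Lemma simplex_lam_max w d : d != 0 -> in_simplex w ->
  in_simplex (w + lam_max w d *: d).
Proof.
move=> d0 Dw; set steps := [set l : R | in_simplex (w + l *: d)].
have steps_neq0 : steps !=set0 by exists 0; rewrite /steps/= scale0r addr0.
have steps_closed : closed steps.
  apply: preimage_closed (@simplex_closed R n) => l _.
  by apply: cvgD; [exact: cvg_cst|apply: cvgZr_tmp; exact: cvg_id].
exact: steps_closed (closure_sup steps_neq0 (has_ubound_steps w d0)).
Qed.

Lemma simplex_step w d l : d != 0 -> in_simplex w -> 0 <= l <= lam_max w d ->
  in_simplex (w + l *: d).
Proof.
move=> d0 Dw /andP[l0 l_le]; set lm := lam_max w d in l_le.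
have [lm_le0|lm0] := leP lm 0.
  have -> : l = 0 by apply/eqP; rewrite eq_le l0 (le_trans l_le).
  by rewrite scale0r addr0.
have t01 : 0 <= l / lm <= 1.
  by rewrite divr_ge0 ?(ltW lm0)//= ler_pdivrMr ?mul1r.
have /convex_setTP Dconvex := @simplex_convex R n.
have := Dconvex _ _ _ t01 (simplex_lam_max d0 Dw) Dw.
rewrite -/lm scalerDr scalerA divfK ?gt_eqF// addrAC -scalerDl.
by rewrite subrKC scale1r.
Qed.

End feasible_steps.

Section trial_steps.
Context {R : realType}.
Variables (beta l0 : R).
Hypotheses (beta01 : 0 < beta < 1) (l0_ge1 : 1 <= l0).

Lemma ls_trialE j : ls_trial beta l0 j = Num.max 1 (beta ^+ j * l0).
Proof.
have /andP[b0 b1] := beta01; elim: j => [|j ih].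
  by rewrite expr0 mul1r max_r.
rewrite /ls_trial iterS -/(ls_trial beta l0 j) ih maxr_pMr ?ltW//.
by rewrite mulr1 mulrA -exprS maxA (max_l (ltW b1)).
Qed.

Lemma ls_trial_bounds j : 1 <= ls_trial beta l0 j <= l0.
Proof.
have /andP[b0 b1] := beta01; rewrite ls_trialE le_max lexx/= ge_max l0_ge1/=.
by rewrite ler_piMl ?exprn_ile1 ?ltW// (lt_le_trans ltr01).
Qed.

Lemma ls_trial_eventually1 : exists j, ls_trial beta l0 j = 1.
Proof.
have /andP[b0 b1] := beta01.
have : beta ^+ j * l0 @[j --> \oo] --> 0 * l0.
  by apply: cvgMr_tmp; apply: cvg_expr; rewrite gtr0_norm.
rewrite mul0r => /cvgr0Pnorm_le/(_ 1 ltr01)[j _ /(_ j (leqnn j))/= le1].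
by exists j; rewrite ls_trialE max_l// (le_trans (ler_norm _)).
Qed.

End trial_steps.

Section line_search.
Context {R : realType} {n : nat}.
Variables (phi : 'rV[R]_n -> R) (rho beta : R) (w d : 'rV[R]_n).
Hypotheses (beta01 : 0 < beta < 1) (lam_max_ge1 : 1 <= lam_max w d).

Lemma line_search_terminates : phi (w + d) <= phi w - rho * sqnorm d ->
  exists j, armijo phi rho w d (ls_trial beta (lam_max w d) j).
Proof.
move=> dec; have [j trial1] := ls_trial_eventually1 beta01 lam_max_ge1.
by exists j; rewrite trial1 /armijo scale1r expr1n mulr1.
Qed.

Lemma ls_output_bounds l :
  ls_output phi rho beta w d l -> 1 <= l <= lam_max w d.
Proof. by move=> [j [_ [_ ->]]]; exact: ls_trial_bounds. Qed.

Lemma ls_output_armijo l : ls_output phi rho beta w d l -> armijo phi rho w d l.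
Proof. by move=> [j [arm [_ ->]]]. Qed.

End line_search.

Section sums_along_sequences.
Context {R : realType} {I : Type}.
Implicit Types (r : seq I) (F G : I -> R).

Lemma sum_nth_map r F m :
  \sum_(j < m) nth 0 [seq F i | i <- r] j = \sum_(i <- take m r) F i.
Proof.
elim: r m => [|i r ih] [|m]; rewrite ?big_ord0 ?big_nil//=.
  by rewrite big1// => j _; rewrite nth_nil.
by rewrite big_ord_recl big_cons/= ih.
Qed.

Lemma nth_mapM r F G j :
  nth 0 [seq F i | i <- r] j * nth 0 [seq G i | i <- r] j
    = nth 0 [seq F i * G i | i <- r] j.
Proof. by elim: r j => [|i r ih] [|j] //=; rewrite mul0r. Qed.

End sums_along_sequences.

Lemma threshold_weights_min {R : realType} {I : finType}
    (p q q' v : I -> R) (t : R) :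
  (forall i, v i < t -> q i = p i) -> (forall i, t < v i -> q i = 0) ->
  (forall i, 0 <= q' i <= p i) -> \sum_i q i = \sum_i q' i ->
  \sum_i q i * v i <= \sum_i q' i * v i.
Proof.
move=> q_low q_high q'01 qq'.
have : \sum_i q i * (v i - t) <= \sum_i q' i * (v i - t).
  apply: ler_sum => i _; have /andP[q'0 q'p] := q'01 i.
  have [vt|tv|->] := ltgtP (v i) t; last by rewrite subrr !mulr0.
  - by rewrite q_low// ler_wnM2r// subr_le0 ltW.
  - by rewrite q_high// mul0r mulr_ge0// subr_ge0 ltW.
under eq_bigr do rewrite mulrBr; under [leRHS]eq_bigr do rewrite mulrBr.
by rewrite !sumrB -!mulr_suml qq' lerD2r.
Qed.

Definition greedy_weights {R : realType} {I : eqType} (p : I -> R)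
    (s : seq I) (i0 : I) (eps : R) (i : I) : R :=
  if i \in s then p i else if i == i0 then eps else 0.

Lemma sum_greedy_weights {R : realType} {I : eqType} (p F : I -> R) (eps : R)
    (s1 s2 : seq I) (i0 : I) : uniq (s1 ++ i0 :: s2) ->
  \sum_(i <- s1 ++ i0 :: s2) greedy_weights p s1 i0 eps i * F i
    = \sum_(i <- s1) p i * F i + eps * F i0.
Proof.
rewrite cat_uniq /= => /and4P[_ /norP[i0s1 /hasPn s2s1] i0s2 _].
rewrite big_cat big_cons /= {2}/greedy_weights (negbTE i0s1) eqxx.
rewrite (eq_big_seq (fun i => p i * F i)) => [|i is1]; last first.
  by rewrite /greedy_weights is1.
rewrite [X in _ + (_ + X)]big1_seq ?addr0// => i /= is2.
rewrite /greedy_weights (negbTE (s2s1 _ is2)) (_ : i == i0 = false) ?mul0r//.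
by apply: contraNF i0s2 => /eqP <-.
Qed.

Definition level_weights {R : realType} {I : finType} (p : I -> R) (a : R)
    (q : I -> R) : Prop :=
  (forall i, 0 <= q i <= p i) /\ \sum_i q i = a.

Section cvar.
Context {R : realType} {S : nat}.
Variables (p v : 'I_S -> R) (a : R).
Hypothesis p_sum1 : \sum_(j < S) p j = 1.
Hypothesis a01 : 0 < a < 1.

Lemma size_scen_order : size (scen_order v) = S.
Proof. by rewrite size_sort size_enum_ord. Qed.

Lemma sum_scen_order (F : 'I_S -> R) :
  \sum_(j < S) F j = \sum_(j <- scen_order v) F j.
Proof. by rewrite -big_enum; apply: perm_big; rewrite perm_sym perm_sort. Qed.

Lemma pairwise_scen_order : pairwise (fun i j => v i <= v j) (scen_order v).
Proof.
have le_v_trans : transitive (fun i j => v i <= v j).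
  by move=> ? ? ?; exact: le_trans.
rewrite -(sorted_pairwise le_v_trans); apply: sort_sorted => i j.
exact: le_total.
Qed.

Lemma psum_take m : psum p v m = \sum_(j <- take m (scen_order v)) p j.
Proof. exact: sum_nth_map. Qed.

Lemma cvar_k_bounds : [/\ (cvar_k p v a < S)%N, psum p v (cvar_k p v a) < a
  & a <= psum p v (cvar_k p v a).+1].
Proof.
have /andP[a0 a1] := a01.
have : (0 < #|[pred m : 'I_S.+1 | (psum p v m < a)%R]|)%N.
  by apply/card_gt0P; exists ord0; rewrite inE psum_take take0 big_nil.
move=> /(eq_bigmax_cond (fun m : 'I_S.+1 => (m : nat)))[m].
rewrite inE => psum_m m_max; have kE : cvar_k p v a = m by rewrite -m_max.
have mS : (m < S)%N.
  rewrite ltn_neqAle -ltnS ltn_ord andbT; apply: contraTneq psum_m => ->.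
  rewrite psum_take take_oversize ?size_scen_order// -sum_scen_order p_sum1.
  by rewrite -leNgt ltW.
rewrite kE; split=> //; rewrite leNgt; apply/negP => psum_m1.
have := @leq_bigmax_cond _ (fun m : 'I_S.+1 => (psum p v m < a)%R)
  (fun m : 'I_S.+1 => (m : nat)) (Ordinal (mS : (m.+1 < S.+1)%N)) psum_m1.
by rewrite -/(cvar_k p v a) kE ltnn.
Qed.

(* [s1] is the list of the scenarios 1, ..., k of the paper, after relabelling,
   and [j0] is the scenario k+1, at which the level [a] is reached. *)
Lemma cvar_split : exists s1 j0 s2,
  [/\ scen_order v = s1 ++ j0 :: s2,
      \sum_(j <- s1) p j < a <= \sum_(j <- s1) p j + p j0 &
      a * cvar_vals p v a
        = \sum_(j <- s1) p j * v j + (a - \sum_(j <- s1) p j) * v j0].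
Proof.
have [kS k_lt k_ge] := cvar_k_bounds; have /andP[a0 _] := a01.
set k := cvar_k p v a in kS k_lt k_ge.
case s2E: (drop k (scen_order v)) => [|j0 s2].
  have := size_drop k (scen_order v); rewrite s2E size_scen_order => /esym/eqP.
  by rewrite subn_eq0 leqNgt kS.
pose s1 := take k (scen_order v).
have size_s1 : size s1 = k by rewrite size_takel// size_scen_order ltnW.
have oE : scen_order v = s1 ++ j0 :: s2 by rewrite -s2E cat_take_drop.
have psum_s1 : psum p v k = \sum_(j <- s1) p j by exact: psum_take.
exists s1, j0, s2; split=> //.
  rewrite -psum_s1 k_lt (le_trans k_ge)// psum_take oE take_cat size_s1.
  by rewrite ltnNge leqnSn/= subSnn/= take0 big_cat big_seq1/= psum_s1.
rewrite /cvar_vals /cvar_eps -/k -psum_s1.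
under eq_bigr do rewrite nth_mapM.
rewrite sum_nth_map -/s1 [nth 0 (sorted_vals v) k](_ : _ = v j0).
  by field; rewrite gt_eqF.
by rewrite /sorted_vals oE map_cat nth_cat size_map size_s1 ltnn subnn.
Qed.

Hypothesis p_ge0 : forall j, 0 <= p j.

Lemma cvar_vals_min : exists2 q, level_weights p a q &
  a * cvar_vals p v a = \sum_(j < S) q j * v j /\
  forall q', level_weights p a q' ->
    a * cvar_vals p v a <= \sum_(j < S) q' j * v j.
Proof.
have [s1 [j0 [s2 [oE /andP[e0 ep] cvarE]]]] := cvar_split.
pose eps := a - \sum_(j <- s1) p j; pose q := greedy_weights p s1 j0 eps.
have sum_q F : \sum_(j < S) q j * F j = \sum_(j <- s1) p j * F j + eps * F j0.
  by rewrite sum_scen_order oE sum_greedy_weights// -oE sort_uniq enum_uniq.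
have sum_q1 : \sum_(j < S) q j = a.
  have := sum_q (fun=> 1); under eq_bigr do rewrite mulr1.
  by under [in RHS]eq_bigr do rewrite mulr1; rewrite mulr1 addrC subrK.
have := pairwise_scen_order; rewrite oE pairwise_cat.
move=> /and3P[/allrelP s1_le _ /andP[/allP j0_le _]].
exists q; first split=> // j.
  rewrite /q /greedy_weights; case: ifP => _; first by rewrite p_ge0 lexx.
  case: eqP => [->|_]; last by rewrite lexx p_ge0.
  by rewrite subr_ge0 ltW//= lerBlDl.
split=> [|q' [q'p q'a]]; rewrite cvarE -/eps -sum_q//.
apply: (threshold_weights_min (t := v j0)) q'p _ => [j|j|]; last by rewrite q'a.
- have : j \in scen_order v by rewrite mem_sort mem_enum.
  rewrite oE mem_cat /q /greedy_weights; case: (j \in s1) => //=.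
  rewrite inE => /orP[/eqP->|/j0_le]; first by rewrite ltxx.
  by rewrite leNgt => /negbTE ->.
- rewrite /q /greedy_weights; case: ifP => [js1|_]; last first.
    by case: eqP => // ->; rewrite ltxx.
  by have := s1_le _ _ js1 (mem_head j0 s2); rewrite leNgt => /negbTE ->.
Qed.

End cvar.

Lemma bounded_subgradientsN_CVaR (R : realType) (n S : nat)
    (x : 'I_S -> 'rV[R]_n) (p : 'I_S -> R) (a : R) :
  (forall j, 0 <= p j <= 1) -> \sum_(j < S) p j = 1 -> 0 < a < 1 ->
  bounded_subgradients (fun w => - CVaR x p a w).
Proof.
move=> p01 p_sum1 a01; have /andP[a0 _] := a01.
have p_ge0 j : 0 <= p j by case/andP: (p01 j).
have ia0 : 0 <= a^-1 by rewrite invr_ge0 ltW.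
exists (a^-1 * \sum_(j < S) `|x j|) => w.
have [q [qp q_sum] [wE _]] := cvar_vals_min (port_vals x w) p_sum1 a01 p_ge0.
pose s := \sum_(j < S) q j *: x j.
have sE z : dotv s z = \sum_(j < S) q j * dotv z (x j).
  by rewrite dotv_suml; apply: eq_bigr => j _; rewrite dotvZl dotvC.
exists (- (a^-1 *: s)) => [z|]; last first.
  rewrite normrN normrZ ger0_norm// ler_wpM2l//.
  apply: le_trans (ler_norm_sum _ _ _) _; apply: ler_sum => j _.
  have /andP[q0 q_le_p] := qp j; have /andP[_ p_le1] := p01 j.
  by rewrite normrZ ger0_norm// ler_piMl// (le_trans q_le_p).
have [_ _ [_ zmin]] := cvar_vals_min (port_vals x z) p_sum1 a01 p_ge0.
have CVaRE v : CVaR x p a v = a^-1 * (a * cvar_vals p (port_vals x v) a).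
  by rewrite mulKf// gt_eqF.
rewrite dotvNl dotvZl dotvBr !CVaRE wE -sE.
by have := ler_wpM2l ia0 (zmin q (conj qp q_sum)); rewrite -sE; lra.
Qed.

Section portfolio.
Context {R : realType} {n S : nat}.
Variables (x : 'I_S -> 'rV[R]_n) (p : 'I_S -> R) (al ga rmin tau rho : R).
Hypotheses (p01 : forall j, 0 <= p j <= 1) (p_sum1 : \sum_(j < S) p j = 1).
Hypotheses (al01 : 0 < al < 1) (tau_gt0 : 0 < tau).
Hypothesis ga_eps : forall v : 'rV[R]_n, 0 < ga < CVaR_eps x p al v.

Lemma level_diff_bounds : 0 < al - ga < 1.
Proof.
have /andP[al0 al1] := al01; have /andP[ga0 ga_lt] := ga_eps 0.
have psum_ge0 v m : 0 <= psum p v m.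
  by rewrite psum_take sumr_ge0// => j _; case/andP: (p01 j).
have := psum_ge0 (port_vals x 0) (cvar_k p (port_vals x 0) al).
by move: ga_lt; rewrite /CVaR_eps /cvar_eps => ? ?; apply/andP; split; lra.
Qed.

Lemma level_ratio_ge0 : 0 <= (al - ga) / ga.
Proof.
have /andP[d0 _] := level_diff_bounds; have /andP[ga0 _] := ga_eps 0.
by rewrite divr_ge0 ?ltW.
Qed.

Lemma bounded_subgradients_gfunB_psi :
  bounded_subgradients (fun w => gfun x p al ga rmin tau rho w - psi rho w).
Proof.
have /andP[ga0 _] := ga_eps 0; have /andP[al0 _] := al01.
pose s := - \sum_(j < S) p j *: x j.
have sE w : ffun_obj x p w = dotv s w.
  rewrite dotvNl dotv_suml; congr (- _); apply: eq_bigr => j _.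
  by rewrite dotvZl dotvC.
rewrite (_ : (fun w => _) = fun w => dotv s w +
  tau * Num.max (al / ga * - CVaR x p al w + rmin)
                ((al - ga) / ga * - CVaR x p (al - ga) w)); last first.
  by apply/funext => w; rewrite /gfun sE !mulrN !mulNr; ring.
apply: bounded_subgradientsD; first exact: bounded_subgradients_dotv.
apply: (bounded_subgradientsZ (ltW tau_gt0)); apply: bounded_subgradients_max.
  apply: bounded_subgradientsD; last exact: bounded_subgradients_cst.
  apply: bounded_subgradientsZ; first by rewrite divr_ge0 ?ltW.
  exact: bounded_subgradientsN_CVaR.
apply: (bounded_subgradientsZ level_ratio_ge0).
exact: bounded_subgradientsN_CVaR level_diff_bounds.
Qed.

Lemma bounded_subgradients_hfunB_psi :
  bounded_subgradients (fun w => hfun x p al ga tau rho w - psi rho w).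
Proof.
rewrite (_ : (fun w => _) =
  fun w => tau * ((al - ga) / ga) * - CVaR x p (al - ga) w); last first.
  by apply/funext => w; rewrite /hfun; ring.
apply: bounded_subgradientsZ.
  by rewrite mulr_ge0 ?level_ratio_ge0// ltW.
exact: bounded_subgradientsN_CVaR level_diff_bounds.
Qed.

End portfolio.

(* [lam k] is constrained only if the backtracking stops: that it does is a
   property of the algorithm, not part of its definition. *)
Record bdca_run {R : realType} {n : nat} (g h : 'rV[R]_n -> R) (rho beta : R)
    (w y u : nat -> 'rV[R]_n) (lam : nat -> R) : Prop := {
  run_start : in_simplex (w 0%N);
  run_subdiff : forall k, subdiff h (w k) (u k);
  run_argmin : forall k, in_simplex (y k) /\
    forall z, in_simplex z -> g (y k) - dotv (y k) (u k) <= g z - dotv z (u k);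
  run_stop : forall k, y k = w k -> w k.+1 = w k;
  run_search : forall k, y k != w k ->
    (exists j, armijo (g \- h) rho (w k) (y k - w k)
       (ls_trial beta (lam_max (w k) (y k - w k)) j)) ->
    ls_output (g \- h) rho beta (w k) (y k - w k) (lam k);
  run_step : forall k, y k != w k -> w k.+1 = w k + lam k *: (y k - w k)
}.

Section bdca.
Context {R : realType} {n : nat}.
Variables (g h : 'rV[R]_n -> R) (rho beta : R).
Variables (w y u : nat -> 'rV[R]_n) (lam : nat -> R).
Hypotheses (rho_gt0 : 0 < rho) (beta01 : 0 < beta < 1).
Hypothesis g_convex : strongly_convex rho g.
Hypothesis h_convex : strongly_convex rho h.
Hypotheses (g_continuous : continuous g) (h_continuous : continuous h).
Hypothesis run : bdca_run g h rho beta w y u lam.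

Let phi := g \- h.
Let d k := y k - w k.

Lemma unit_step_decrease k : in_simplex (w k) ->
  phi (y k) <= phi (w k) - rho * sqnorm (d k).
Proof.
have [Dy y_min] := run_argmin run k => Dw.
exact: dca_decrease g_convex h_convex simplex_convex Dw Dy
  (run_subdiff run k) y_min.
Qed.

Lemma run_lam_max_ge1 k : y k != w k -> 1 <= lam_max (w k) (d k).
Proof.
move=> yw; apply: lam_max_ge; rewrite ?subr_eq0// scale1r subrKC.
by case: (run_argmin run k).
Qed.

Lemma backtracking_terminates k : in_simplex (w k) -> y k != w k ->
  exists j, armijo phi rho (w k) (d k) (ls_trial beta (lam_max (w k) (d k)) j).
Proof.
move=> Dw yw; apply: line_search_terminates => //; first exact: run_lam_max_ge1.
by rewrite subrKC; exact: unit_step_decrease.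
Qed.

Lemma step_size_bounds k : in_simplex (w k) -> y k != w k ->
  1 <= lam k <= lam_max (w k) (d k).
Proof.
move=> Dw yw; have search := run_search run yw (backtracking_terminates Dw yw).
exact: (ls_output_bounds beta01 (run_lam_max_ge1 yw) search).
Qed.

Lemma bdca_in_simplex k : in_simplex (w k).
Proof.
elim: k => [|k Dw]; first exact: run_start run.
have [/(run_stop run) -> //|yw] := eqVneq (y k) (w k).
have /andP[l1 l_le] := step_size_bounds Dw yw.
rewrite (run_step run)//; apply: simplex_step; rewrite ?subr_eq0//.
by rewrite l_le (le_trans ler01).
Qed.

Lemma dca_point_decrease k : phi (y k) <= phi (w k) - rho * sqnorm (d k).
Proof. exact/unit_step_decrease/bdca_in_simplex. Qed.

Lemma bdca_line_search_terminates k : y k != w k ->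
  exists j, armijo phi rho (w k) (d k) (ls_trial beta (lam_max (w k) (d k)) j).
Proof. exact/backtracking_terminates/bdca_in_simplex. Qed.

Lemma bdca_decrease k :
  phi (w k.+1) <= phi (w k) - rho * lam k ^+ 2 * sqnorm (d k).
Proof.
have [yw|yw] := eqVneq (y k) (w k).
  by rewrite (run_stop run yw) /d yw subrr sqnorm0 mulr0 subr0.
rewrite (run_step run)//.
exact: ls_output_armijo (run_search run yw (bdca_line_search_terminates yw)).
Qed.

Lemma bdca_sufficient_decrease k :
  phi (w k.+1) <= phi (w k) - rho * sqnorm (d k).
Proof.
apply: le_trans (bdca_decrease k) _; rewrite lerD2l lerN2 -mulrA ler_pM2l//.
have [yw|yw] := eqVneq (y k) (w k); first by rewrite /d yw subrr sqnorm0 mulr0.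
have /andP[l1 _] := step_size_bounds (bdca_in_simplex k) yw.
by rewrite ler_peMl ?sqnorm_ge0// exprn_ege1.
Qed.

Lemma bdca_monotone k : phi (w k.+1) <= phi (w k).
Proof.
apply: le_trans (bdca_sufficient_decrease k) _.
by rewrite gerBl mulr_ge0 ?sqnorm_ge0// ltW.
Qed.

Lemma bdca_value_cvg : cvgn (phi \o w).
Proof.
apply: nonincreasing_is_cvgn; first exact/nonincreasing_seqP/bdca_monotone.
have phi_continuous : continuous phi.
  by move=> z; apply: continuousB; [exact: g_continuous|exact: h_continuous].
have [|zmin _ phi_min] := @EVT_min_rV _ _ phi _ _ (@simplex_compact R n)
  (continuous_subspaceT phi_continuous).
  by exists (w 0%N); exact: run_start run.
exists (phi zmin) => _ [k _ <-]; apply: phi_min; rewrite inE.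
exact: bdca_in_simplex.
Qed.

Lemma bdca_direction_cvg0 : d @ \oo --> (0 : 'rV[R]_n).
Proof.
apply: cvg_sqnorm0.
have : rho * sqnorm (d k) @[k --> \oo] --> 0.
  apply: sufficient_decrease_cvg0 bdca_value_cvg _ bdca_sufficient_decrease.
  by move=> k; rewrite mulr_ge0 ?sqnorm_ge0// ltW.
move=> /(@cvgMl_tmp _ _ _ _ _ rho^-1); rewrite mulr0.
by under eq_fun do rewrite mulKf ?gt_eqF//.
Qed.

Lemma bdca_subsequence_cvg : exists (s : nat -> nat) (wb ub : 'rV[R]_n),
  [/\ increasing_seq s, w \o s @ \oo --> wb, u \o s @ \oo --> ub
    & y \o s @ \oo --> wb].
Proof.
have [B uB] := subdiff_bounded 1 h_continuous.
have wu_in k : (@in_simplex R n `*` [set v | `|v| <= B]) (w k, u k).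
  split; first exact: bdca_in_simplex.
  by apply: uB (run_subdiff run k); exact/simplex_norm_le1/bdca_in_simplex.
have [[wb ub] [s s_incr wu_cvg]] :=
  compact_subsequence
    (compact_setX (@simplex_compact R n) (@compact_norm_le R n B)) wu_in.
have w_cvg : w \o s @ \oo --> wb by exact: (cvg_comp _ fst wu_cvg cvg_fst).
have u_cvg : u \o s @ \oo --> ub by exact: (cvg_comp _ snd wu_cvg cvg_snd).
exists s, wb, ub; split=> //.
have -> : y \o s = (w \o s) + (d \o s).
  by apply/funext => k; rewrite fctE subrKC.
rewrite -[X in _ --> X]addr0; apply: (cvgD w_cvg).
exact: (cvg_comp _ d (increasing_seq_cvg s_incr) bdca_direction_cvg0).
Qed.

Lemma bdca_subsequence_KKT : exists (s : nat -> nat) (wb : 'rV[R]_n),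
  [/\ increasing_seq s, w \o s @ \oo --> wb & is_KKT g h wb].
Proof.
have [s [wb [ub [s_incr w_cvg u_cvg y_cvg]]]] := bdca_subsequence_cvg.
exists s, wb; split=> //; apply: (@simplex_min_KKT _ _ _ _ _ ub).
- apply: (strongly_convex_convex (ltW rho_gt0)).
  exact: strongly_convexB_dotv.
- apply: (subdiff_closed h_continuous w_cvg u_cvg) => k.
  exact: (run_subdiff run).
- apply: (closed_cvg _ (@simplex_closed R n) _ _ w_cvg).
  by apply: nearW => k; exact: bdca_in_simplex.
move=> z Dz.
have lhs : g ((y \o s) k) - dotv ((y \o s) k) ((u \o s) k) @[k --> \oo]
    --> g wb - dotv wb ub.
  apply: cvgB; last exact: cvg_dotv.
  exact: (continuous_cvg _ (@g_continuous wb) y_cvg).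
have rhs : g z - dotv z ((u \o s) k) @[k --> \oo] --> g z - dotv z ub.
  by apply: cvgB; [exact: cvg_cst|apply: cvg_dotv => //; exact: cvg_cst].
apply: (ler_cvg_to lhs rhs); apply: nearW => k /=.
by have [_ ymin] := run_argmin run (s k); exact: ymin.
Qed.

End bdca.

Theorem theorem1 (R : realType) (n S : nat) (x : 'I_S -> 'rV[R]_n) (p : 'I_S -> R)
  (al ga rmin tau rho beta : R)
  (w y u : nat -> 'rV[R]_n) (lam : nat -> R) :
  (forall j, 0 <= p j <= 1) -> \sum_(j < S) p j = 1 ->
  0 < al < 1 ->
  (forall v : 'rV[R]_n, 0 < ga < CVaR_eps x p al v) ->
  0 < tau -> 0 < rho -> 0 < beta < 1 ->
  in_simplex (w 0%N) ->
  (forall k, subdiff (hfun x p al ga tau rho) (w k) (u k)) ->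
  (forall k, in_simplex (y k) /\
     forall z, in_simplex z ->
       gfun x p al ga rmin tau rho (y k) - dotv (y k) (u k)
         <= gfun x p al ga rmin tau rho z - dotv z (u k)) ->
  (forall k, y k = w k -> w k.+1 = w k) ->
  (forall k, y k != w k ->
     (exists j, armijo (phifun x p al ga rmin tau rho) rho (w k) (y k - w k)
                  (ls_trial beta (lam_max (w k) (y k - w k)) j)) ->
     ls_output (phifun x p al ga rmin tau rho) rho beta (w k) (y k - w k) (lam k)) ->
  (forall k, y k != w k -> w k.+1 = w k + lam k *: (y k - w k)) ->
  let phi := phifun x p al ga rmin tau rho in
  (* (i) *)
  (forall k, phi (y k) <= phi (w k) - rho * sqnorm (y k - w k)) /\
  (* (ii) *)
  (forall k, y k != w k ->
     exists j, armijo phi rho (w k) (y k - w k)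
                 (ls_trial beta (lam_max (w k) (y k - w k)) j)) /\
  (forall k, phi (w k.+1) <= phi (w k) - rho * lam k ^+ 2 * sqnorm (y k - w k)) /\
  (* (iii) *)
  (forall k, phi (w k.+1) <= phi (w k)) /\
  (exists phib : R, (fun k => phi (w k)) @ \oo --> phib) /\
  (* (iv) *)
  (exists (sg : nat -> nat) (wb : 'rV[R]_n),
     (forall k, (sg k < sg k.+1)%N) /\
     (fun k => w (sg k)) @ \oo --> wb /\
     is_KKT (gfun x p al ga rmin tau rho) (hfun x p al ga tau rho) wb).
Proof.
move=> p01 p_sum1 al01 ga_eps tau0 rho0 beta01 w0 u_sub y_min stop search step.
have g_reg :=
  bounded_subgradients_gfunB_psi rmin rho p01 p_sum1 al01 tau0 ga_eps.
have h_reg := bounded_subgradients_hfunB_psi rho p01 p_sum1 al01 tau0 ga_eps.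
have gc := bounded_subgradients_convex g_reg.
have hc := bounded_subgradients_convex h_reg.
have g_cont := bounded_subgradientsB_psi_continuous g_reg.
have h_cont := bounded_subgradientsB_psi_continuous h_reg.
have run : bdca_run (gfun x p al ga rmin tau rho) (hfun x p al ga tau rho)
  rho beta w y u lam by split.
move=> phi; split; first exact: dca_point_decrease beta01 gc hc run.
split; first exact: bdca_line_search_terminates beta01 gc hc run.
split; first exact: bdca_decrease beta01 gc hc run.
split; first exact: bdca_monotone rho0 beta01 gc hc run.
split; first exact/cvg_ex/(bdca_value_cvg rho0 beta01 gc hc g_cont h_cont run).
have [s [wb [s_incr w_cvg wb_KKT]]] :=
  bdca_subsequence_KKT rho0 beta01 gc hc g_cont h_cont run.
by exists s, wb; split=> //; move/increasing_seqP: s_incr.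
Qed.
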